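(* Let $d\ge1$. The assignment $$\pi(s_a)=\widehat s_a,\qquad \pi(\varepsilon_a)=\widehat\varepsilon_a,\qquad \pi(y_j)=z_j\qquad(1\le a\le d-1,\ 1\le j\le d)$$ defines an algebra epimorphism $\pi:\widehat P_d^-\to A_d$ from the affine periplectic Brauer algebra onto the periplectic Brauer algebra, where $z_j$ are the Jucys–Murphy elements of $A_d$.
   Context: The affine periplectic Brauer algebra $\widehat P_d^-$ is the associative unital $\mathbb C$-algebra generated by $s_a,\varepsilon_a$ ($1\le a\le d-1$), $y_j$ ($1\le j\le d$), subject to (for all indices for which the symbols make sense): (P.1) $s_a^2=1$; (P.2) $s_as_b=s_bs_a$ for $|a-b|>1$; $s_cs_{c+1}s_c=s_{c+1}s_cs_{c+1}$; $s_ay_i=y_is_a$ for $i\notin\{a,a+1\}$; (P.3) $\varepsilon_a^2=0$; (P.4) $\varepsilon_1y_1^k\varepsilon_1=0$ for all integers $k\ge1$; (P.5) $s_a\varepsilon_b=\varepsilon_bs_a$ and $\varepsilon_a\varepsilon_b=\varepsilon_b\varepsilon_a$ for $|a-b|>1$; $\varepsilon_ay_i=y_i\varepsilon_a$ for $i\notin\{a,a+1\}$; $y_iy_j=y_jy_i$; (P.6) $\varepsilon_as_a=-\varepsilon_a=-s_a\varepsilon_a$; $s_c\varepsilon_{c+1}\varepsilon_c=-s_{c+1}\varepsilon_c$, $\varepsilon_c\varepsilon_{c+1}s_c=\varepsilon_cs_{c+1}$; $\varepsilon_{c+1}\varepsilon_cs_{c+1}=-\varepsilon_{c+1}s_c$,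 $s_{c+1}\varepsilon_c\varepsilon_{c+1}=s_c\varepsilon_{c+1}$; $\varepsilon_{c+1}\varepsilon_c\varepsilon_{c+1}=-\varepsilon_{c+1}$, $\varepsilon_c\varepsilon_{c+1}\varepsilon_c=-\varepsilon_c$; (P.7) $s_ay_a-y_{a+1}s_a=\varepsilon_a-1$, $y_as_a-s_ay_{a+1}=-\varepsilon_a-1$; (P.8) $\varepsilon_a(y_a-y_{a+1})=\varepsilon_a$, $(y_a-y_{a+1})\varepsilon_a=-\varepsilon_a$. The periplectic Brauer algebra $A_d$ is the associative unital $\mathbb C$-algebra with generators $\widehat s_a,\widehat\varepsilon_a$ ($1\le a\le d-1$) and defining relations (for all indices for which the symbols make sense): $\widehat s_a^2=1$; $\widehat s_a\widehat s_b=\widehat s_b\widehat s_a$ for $|a-b|>1$; $\widehat s_c\widehat s_{c+1}\widehat s_c=\widehat s_{c+1}\widehat s_c\widehat s_{c+1}$; $\widehat\varepsilon_a^2=0$; $\widehat s_a\widehat\varepsilon_b=\widehat\varepsilon_b\widehat s_a$ and $\widehat\varepsilon_a\widehat\varepsilon_b=\widehat\varepsilon_b\widehat\varepsilon_a$ for $|a-b|>1$; $\widehat\varepsilon_a\widehat s_a=-\widehat\varepsilon_a=-\widehat s_a\widehat\varepsilon_a$; $\widehat s_c\widehat\varepsilon_{c+1}\widehat\varepsilon_c=-\widehat s_{c+1}\widehat\varepsilon_c$, $\widehat\varepsilon_c\widehat\varepsilon_{c+1}\widehat s_c=\widehat\varepsilon_c\widehat s_{c+1}$; $\widehat\varepsilon_{c+1}\widehat\varepsilon_c\widehat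 s_{c+1}=-\widehat\varepsilon_{c+1}\widehat s_c$, $\widehat s_{c+1}\widehat\varepsilon_c\widehat\varepsilon_{c+1}=\widehat s_c\widehat\varepsilon_{c+1}$; $\widehat\varepsilon_{c+1}\widehat\varepsilon_c\widehat\varepsilon_{c+1}=-\widehat\varepsilon_{c+1}$, $\widehat\varepsilon_c\widehat\varepsilon_{c+1}\widehat\varepsilon_c=-\widehat\varepsilon_c$. For $1\le i<j\le d$ set $(i,j)=\widehat s_i\widehat s_{i+1}\cdots\widehat s_{j-2}\,\widehat s_{j-1}\,\widehat s_{j-2}\cdots\widehat s_i$ and $\overline{(i,j)}=\widehat s_i\widehat s_{i+1}\cdots\widehat s_{j-2}\,\widehat\varepsilon_{j-1}\,\widehat s_{j-2}\cdots\widehat s_i$ in $A_d$. The Jucys–Murphy elements are $z_1=0$ and $z_j=\sum_{1\le k\le j-1}\big((k,j)+\overline{(k,j)}\big)$ for $2\le j\le d$. *)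

(* Defs.v *)
From HB Require Import structures.
From mathcomp Require Import all_boot all_order all_algebra.
From mathcomp Require Import generic_quotient ring_quotient.
From mathcomp Require Import boolp reals complex monalg.

Set Implicit Arguments.
Unset Strict Implicit.
Unset Printing Implicit Defensive.

Import GRing.Theory.
Local Open Scope ring_scope.
Local Open Scope quotient_scope.

Definition free_alg (K : comNzRingType) (X : choiceType) := {malg K[{fmonom X}]}.

Section FreeAlgebra.
Variables (K : comNzRingType) (X : choiceType).

HB.instance Definition _ := GRing.Lalgebra.on (free_alg K X).

Lemma free_alg_scaleAr (c : K) (u v : free_alg K X) :
  c *: (u * v) = u * (c *: v).
Proof.
apply/malgP => m; rewrite mcoeffZ [in LHS]mcoeffMl.
rewrite (@mcoeffMlw _ _ (msupp u) (msupp v) u (c *: v)) ?fsubset_refl ?msuppZ_le //.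
rewrite mulr_sumr; apply: eq_bigr => k1 _.
rewrite mulr_sumr; apply: eq_bigr => k2 _.
by rewrite mcoeffZ mulrnAr mulrCA.
Qed.

HB.instance Definition _ :=
  GRing.Lalgebra_isAlgebra.Build K (free_alg K X) free_alg_scaleAr.

Definition free_gen (x : X) : free_alg K X := mkmalgU (fmu x) 1.

Definition word_val (v : X -> K) (m : {fmonom X}) : K := \prod_(x <- m) v x.

Lemma word_val_mmorphism (v : X -> K) : mmorphism (word_val v).
Proof.
split=> [m1 m2|]; first by rewrite /word_val fmM big_cat.
by rewrite /word_val fm1 big_nil.
Qed.

HB.instance Definition _ (v : X -> K) :=
  isMultiplicative.Build {fmonom X} K (word_val v) (word_val_mmorphism v).

Definition free_eval (v : X -> K) : {rmorphism free_alg K X -> K} :=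
  mmap idfun (word_val v).

Lemma free_eval_gen (v : X -> K) (x : X) : free_eval v (free_gen x) = v x.
Proof. by rewrite /free_eval /= mmapU /word_val fmU big_seq1 mul1r. Qed.

End FreeAlgebra.

(* The two-sided ideal of A generated by the elements l - r with E l r.
   Closure under opposites and scalars comes from the factor a. *)
Inductive rel_ideal (A : nzRingType) (E : A -> A -> Prop) : A -> Prop :=
| rel_ideal0 : rel_ideal E 0
| rel_idealD u v : rel_ideal E u -> rel_ideal E v -> rel_ideal E (u + v)
| rel_idealM a l r b : E l r -> rel_ideal E (a * (l - r) * b).

Lemma rel_ideal_ker (A B : nzRingType) (E : A -> A -> Prop)
    (f : {rmorphism A -> B}) (x : A) :
  (forall l r, E l r -> f l = f r) -> rel_ideal E x -> f x = 0.
Proof.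
move=> fE; elim=> [|u v _ fu _ fv|a l r b /fE flr].
- by rewrite rmorph0.
- by rewrite rmorphD fu fv addr0.
- by rewrite !rmorphM rmorphB flr subrr mulr0 mul0r.
Qed.

Lemma rel_ideal_proper (A B : nzRingType) (E : A -> A -> Prop)
    (f : {rmorphism A -> B}) :
  (forall l r, E l r -> f l = f r) -> ~ rel_ideal E 1.
Proof.
move=> fE /(rel_ideal_ker fE); rewrite rmorph1; apply/eqP/oner_neq0.
Qed.

Section RelIdeal.
Variables (A : nzRingType) (E : A -> A -> Prop).

Definition rel_ideal_pred : {pred A} := fun x => `[< rel_ideal E x >].

Lemma rel_ideal_mul x y z : rel_ideal E y -> rel_ideal E (x * y * z).
Proof.
elim=> [|u v _ Iu _ Iv|a l r b Elr].
- by rewrite mulr0 mul0r; constructor.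
- by rewrite mulrDr mulrDl; constructor.
- by rewrite !mulrA -(mulrA _ b); constructor.
Qed.

Lemma rel_ideal_zmod_closed : zmod_closed rel_ideal_pred.
Proof.
split=> [|u v /asboolP Iu /asboolP Iv]; apply/asboolP; first by constructor.
constructor=> //; rewrite -[- v]mulr1 -mulN1r.
exact: rel_ideal_mul.
Qed.

HB.instance Definition _ :=
  GRing.isZmodClosed.Build A rel_ideal_pred rel_ideal_zmod_closed.

End RelIdeal.

(* The quotient of A by the two-sided ideal generated by E. The properness
   proof is needed because the rings underlying algType are nontrivial;
   ring_quotient only covers commutative rings. *)
Definition alg_quot (K : comNzRingType) (A : algType K) (E : A -> A -> Prop)
  (properE : ~ rel_ideal E 1) := Quotient.quot (rel_ideal_pred E : zmodClosed A).

Section AlgQuotient.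
Variables (K : comNzRingType) (A : algType K) (E : A -> A -> Prop).
Variable properE : ~ rel_ideal E 1.

Local Notation Q := (alg_quot properE).

HB.instance Definition _ := GRing.Zmodule.on Q.

Definition alg_proj (x : A) : Q := \pi_(Quotient.quot (rel_ideal_pred E : zmodClosed A)) x.
Let rep (q : Q) : A := repr (q : Quotient.quot (rel_ideal_pred E : zmodClosed A)).

Let repK (q : Q) : alg_proj (rep q) = q.
Proof. exact: reprK. Qed.

Lemma alg_projP (x y : A) : alg_proj x = alg_proj y <-> rel_ideal E (x - y).
Proof.
split=> [/eqP|Ixy]; last apply/eqP.
  by rewrite -[_ == _]Quotient.idealrBE => /asboolP.
by rewrite -[_ == _]Quotient.idealrBE; apply/asboolP.
Qed.

Lemma alg_projB : zmod_morphism alg_proj.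
Proof. by move=> x y; rewrite /alg_proj raddfB. Qed.

HB.instance Definition _ := GRing.isZmodMorphism.Build A Q alg_proj alg_projB.

Definition alg_quot_mul (p q : Q) : Q := alg_proj (rep p * rep q).
Definition alg_quot_scale (c : K) (q : Q) : Q := alg_proj (c *: rep q).

Lemma alg_proj_mul x y : alg_proj (x * y) = alg_quot_mul (alg_proj x) (alg_proj y).
Proof.
set x' := rep (alg_proj x); set y' := rep (alg_proj y).
have /alg_projP Ix : alg_proj x = alg_proj x' by rewrite repK.
have /alg_projP Iy : alg_proj y = alg_proj y' by rewrite repK.
apply/alg_projP.
have -> : x * y - x' * y' = 1 * (x - x') * y + x' * (y - y') * 1.
  by rewrite mul1r mulr1 mulrBl mulrBr addrA addrNK.
by constructor; apply: rel_ideal_mul.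
Qed.

Lemma alg_proj_scale c x : alg_proj (c *: x) = alg_quot_scale c (alg_proj x).
Proof.
have /alg_projP Ix : alg_proj x = alg_proj (rep (alg_proj x)) by rewrite repK.
apply/alg_projP; rewrite -scalerBr -[_ *: _]mulr1 -[X in c *: X]mul1r scalerAl.
exact: rel_ideal_mul.
Qed.

Lemma alg_quot_mulA : associative alg_quot_mul.
Proof.
by move=> p q r; rewrite -[p]repK -[q]repK -[r]repK -!alg_proj_mul mulrA.
Qed.

Lemma alg_quot_mul1 : left_id (alg_proj 1) alg_quot_mul.
Proof. by move=> p; rewrite -[p]repK -alg_proj_mul mul1r. Qed.

Lemma alg_quot_mulr1 : right_id (alg_proj 1) alg_quot_mul.
Proof. by move=> p; rewrite -[p]repK -alg_proj_mul mulr1. Qed.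

Lemma alg_quot_mulDl : left_distributive alg_quot_mul +%R.
Proof.
move=> p q r; rewrite -[p]repK -[q]repK -[r]repK -raddfD -!alg_proj_mul.
by rewrite mulrDl raddfD.
Qed.

Lemma alg_quot_mulDr : right_distributive alg_quot_mul +%R.
Proof.
move=> p q r; rewrite -[p]repK -[q]repK -[r]repK -raddfD -!alg_proj_mul.
by rewrite mulrDr raddfD.
Qed.

Lemma alg_quot_1neq0 : alg_proj 1 != 0.
Proof.
apply/eqP; rewrite -(raddf0 alg_proj) => /alg_projP.
by rewrite subr0.
Qed.

HB.instance Definition _ := GRing.Zmodule_isNzRing.Build Q
  alg_quot_mulA alg_quot_mul1 alg_quot_mulr1 alg_quot_mulDl alg_quot_mulDr
  alg_quot_1neq0.

Lemma alg_quot_scaleA c d q :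
  alg_quot_scale c (alg_quot_scale d q) = alg_quot_scale (c * d) q.
Proof. by rewrite -[q]repK -!alg_proj_scale scalerA. Qed.

Lemma alg_quot_scale1 : left_id 1 alg_quot_scale.
Proof. by move=> q; rewrite -[q]repK -alg_proj_scale scale1r. Qed.

Lemma alg_quot_scaleDr : right_distributive alg_quot_scale +%R.
Proof.
move=> c p q; rewrite -[p]repK -[q]repK -raddfD -!alg_proj_scale.
by rewrite scalerDr raddfD.
Qed.

Lemma alg_quot_scaleDl q : {morph alg_quot_scale^~ q : c d / c + d}.
Proof.
by move=> c d; rewrite -[q]repK -!alg_proj_scale scalerDl raddfD.
Qed.

HB.instance Definition _ := GRing.Zmodule_isLmodule.Build K Q
  alg_quot_scaleA alg_quot_scale1 alg_quot_scaleDr alg_quot_scaleDl.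

Lemma alg_quot_scaleAl (c : K) (p q : Q) : c *: (p * q) = c *: p * q.
Proof.
have ZE x : c *: alg_proj x = alg_proj (c *: x) by rewrite alg_proj_scale.
have ME x y : alg_proj x * alg_proj y = alg_proj (x * y) by rewrite alg_proj_mul.
by rewrite -[p]repK -[q]repK !(ME, ZE) scalerAl.
Qed.

HB.instance Definition _ := GRing.Lmodule_isLalgebra.Build K Q alg_quot_scaleAl.

Lemma alg_quot_scaleAr (c : K) (p q : Q) : c *: (p * q) = p * (c *: q).
Proof.
have ZE x : c *: alg_proj x = alg_proj (c *: x) by rewrite alg_proj_scale.
have ME x y : alg_proj x * alg_proj y = alg_proj (x * y) by rewrite alg_proj_mul.
by rewrite -[p]repK -[q]repK !(ME, ZE) scalerAr.
Qed.

HB.instance Definition _ := GRing.Lalgebra_isAlgebra.Build K Q alg_quot_scaleAr.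

Lemma alg_proj_monoid : monoid_morphism alg_proj.
Proof. by split=> // x y; rewrite alg_proj_mul. Qed.

HB.instance Definition _ := GRing.isMonoidMorphism.Build A Q alg_proj alg_proj_monoid.

Lemma alg_proj_scalable : scalable alg_proj.
Proof. by move=> c x; rewrite alg_proj_scale. Qed.

HB.instance Definition _ := GRing.isScalable.Build K A Q *:%R alg_proj alg_proj_scalable.

End AlgQuotient.

(* Indices are shifted down by one: s_a, e_a and y_j in the mathematical
   notation are s, e at the ordinal a - 1 : 'I_d.-1 and y at j - 1 : 'I_d.
   An ordinal c' with c' = c.+1 :> nat plays the role of c + 1. *)

Definition far (n : nat) (a b : 'I_n) : bool := (1 < `|(a : nat) - (b : nat)|)%N.

Inductive brauer_rel (A : nzRingType) (d : nat) (s e : 'I_d.-1 -> A) :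
  A -> A -> Prop :=
| rel_ss a : brauer_rel s e (s a ^+ 2) 1
| rel_ss_far a b : far a b -> brauer_rel s e (s a * s b) (s b * s a)
| rel_braid (c c' : 'I_d.-1) : c' = c.+1 :> nat ->
    brauer_rel s e (s c * s c' * s c) (s c' * s c * s c')
| rel_ee a : brauer_rel s e (e a ^+ 2) 0
| rel_se_far a b : far a b -> brauer_rel s e (s a * e b) (e b * s a)
| rel_ee_far a b : far a b -> brauer_rel s e (e a * e b) (e b * e a)
| rel_es a : brauer_rel s e (e a * s a) (- e a)
| rel_se a : brauer_rel s e (- e a) (- (s a * e a))
| rel_see (c c' : 'I_d.-1) : c' = c.+1 :> nat ->
    brauer_rel s e (s c * e c' * e c) (- (s c' * e c))
| rel_ees (c c' : 'I_d.-1) : c' = c.+1 :> nat ->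
    brauer_rel s e (e c * e c' * s c) (e c * s c')
| rel_ees' (c c' : 'I_d.-1) : c' = c.+1 :> nat ->
    brauer_rel s e (e c' * e c * s c') (- (e c' * s c))
| rel_see' (c c' : 'I_d.-1) : c' = c.+1 :> nat ->
    brauer_rel s e (s c' * e c * e c') (s c * e c')
| rel_eee' (c c' : 'I_d.-1) : c' = c.+1 :> nat ->
    brauer_rel s e (e c' * e c * e c') (- e c')
| rel_eee (c c' : 'I_d.-1) : c' = c.+1 :> nat ->
    brauer_rel s e (e c * e c' * e c) (- e c).

Inductive affine_brauer_rel (A : nzRingType) (d : nat) (s e : 'I_d.-1 -> A)
  (y : 'I_d -> A) : A -> A -> Prop :=
| rel_brauer u v : brauer_rel s e u v -> affine_brauer_rel s e y u v
| rel_sy (a : 'I_d.-1) (i : 'I_d) : i != a :> nat -> i != a.+1 :> nat ->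
    affine_brauer_rel s e y (s a * y i) (y i * s a)
| rel_eye (a : 'I_d.-1) (i : 'I_d) (k : nat) :
    a = 0%N :> nat -> i = 0%N :> nat -> (1 <= k)%N ->
    affine_brauer_rel s e y (e a * y i ^+ k * e a) 0
| rel_ey (a : 'I_d.-1) (i : 'I_d) : i != a :> nat -> i != a.+1 :> nat ->
    affine_brauer_rel s e y (e a * y i) (y i * e a)
| rel_yy (i j : 'I_d) : affine_brauer_rel s e y (y i * y j) (y j * y i)
| rel_sy_ys (a : 'I_d.-1) (i i' : 'I_d) : i = a :> nat -> i' = a.+1 :> nat ->
    affine_brauer_rel s e y (s a * y i - y i' * s a) (e a - 1)
| rel_ys_sy (a : 'I_d.-1) (i i' : 'I_d) : i = a :> nat -> i' = a.+1 :> nat ->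
    affine_brauer_rel s e y (y i * s a - s a * y i') (- e a - 1)
| rel_eyy (a : 'I_d.-1) (i i' : 'I_d) : i = a :> nat -> i' = a.+1 :> nat ->
    affine_brauer_rel s e y (e a * (y i - y i')) (e a)
| rel_yye (a : 'I_d.-1) (i i' : 'I_d) : i = a :> nat -> i' = a.+1 :> nat ->
    affine_brauer_rel s e y ((y i - y i') * e a) (- e a).

(* The representation s |-> 1, e |-> 0, y_j |-> j shows that neither
   presentation collapses. *)
Lemma brauer_rel_aug (A B : nzRingType) (f : {rmorphism A -> B}) (d : nat)
    (s e : 'I_d.-1 -> A) (l r : A) :
  (forall a, f (s a) = 1) -> (forall a, f (e a) = 0) ->
  brauer_rel s e l r -> f l = f r.
Proof.
move=> fs fe; case=> *;
by rewrite ?(rmorphN, rmorphM, rmorphXn, rmorph1, rmorph0) /= ?fs ?fe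
  ?(mulr0, mul0r, mulr1, expr1n, expr0n, oppr0).
Qed.

Lemma affine_brauer_rel_aug (A B : nzRingType) (f : {rmorphism A -> B}) (d : nat)
    (s e : 'I_d.-1 -> A) (y : 'I_d -> A) (l r : A) :
  (forall a, f (s a) = 1) -> (forall a, f (e a) = 0) ->
  (forall j, f (y j) = j.+1%:R) ->
  affine_brauer_rel s e y l r -> f l = f r.
Proof.
have succB n : n.+1%:R - n.+2%:R = -1 :> B.
  by rewrite -[n.+2]addn1 natrD opprD addrA subrr sub0r.
move=> fs fe fy; case=> [u w||||i j|a i i' ii i'i|a i i' ii i'i|a i i' _ _|a i i' _ _].
- exact: brauer_rel_aug.
- by move=> a i _ _; rewrite !rmorphM fs mulr1 mul1r.
- by move=> a i k _ _ _; rewrite !rmorphM fe mulr0 rmorph0.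
- by move=> a i _ _; rewrite !rmorphM fe mulr0 mul0r.
- by rewrite !rmorphM !fy -!natrM mulnC.
- by rewrite !rmorphB !rmorphM rmorph1 fs fe !fy ii i'i mulr1 mul1r sub0r.
- by rewrite !rmorphB !rmorphM rmorphN rmorph1 fs fe !fy ii i'i mulr1 mul1r oppr0 sub0r.
- by rewrite rmorphM fe mul0r.
- by rewrite rmorphM rmorphN fe mulr0 oppr0.
Qed.

Section PeriplecticBrauer.
Variables (K : comNzRingType) (d : nat).

Definition brauer_gen : choiceType := ('I_d.-1 + 'I_d.-1)%type.

Definition brauer_relations :
    free_alg K brauer_gen -> free_alg K brauer_gen -> Prop :=
  brauer_rel (d := d) (fun a => free_gen K (inl a : brauer_gen))
                      (fun a => free_gen K (inr a : brauer_gen)).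

Lemma brauer_relations_proper : ~ rel_ideal brauer_relations 1.
Proof.
pose v (x : brauer_gen) : K := if x is inl _ then 1 else 0.
apply: (rel_ideal_proper (f := free_eval v)) => l r.
by apply: brauer_rel_aug => a; rewrite free_eval_gen.
Qed.

Definition periplectic_brauer := alg_quot brauer_relations_proper.
HB.instance Definition _ := GRing.Algebra.on periplectic_brauer.

Definition s_hat (a : 'I_d.-1) : periplectic_brauer :=
  alg_proj brauer_relations_proper (free_gen K (inl a : brauer_gen)).
Definition e_hat (a : 'I_d.-1) : periplectic_brauer :=
  alg_proj brauer_relations_proper (free_gen K (inr a : brauer_gen)).

Definition affine_gen : choiceType := ('I_d.-1 + 'I_d.-1 + 'I_d)%type.

Definition affine_relations :
    free_alg K affine_gen -> free_alg K affine_gen -> Prop :=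
  affine_brauer_rel (d := d) (fun a => free_gen K (inl (inl a) : affine_gen))
                             (fun a => free_gen K (inl (inr a) : affine_gen))
                             (fun j => free_gen K (inr j : affine_gen)).

Lemma affine_relations_proper : ~ rel_ideal affine_relations 1.
Proof.
pose v (x : affine_gen) : K :=
  match x with inl (inl _) => 1 | inl (inr _) => 0 | inr j => j.+1%:R end.
apply: (rel_ideal_proper (f := free_eval v)) => l r.
by apply: affine_brauer_rel_aug => a; rewrite free_eval_gen.
Qed.

Definition affine_periplectic_brauer := alg_quot affine_relations_proper.
HB.instance Definition _ := GRing.Algebra.on affine_periplectic_brauer.

Definition s_aff (a : 'I_d.-1) : affine_periplectic_brauer :=
  alg_proj affine_relations_proper (free_gen K (inl (inl a) : affine_gen)).
Definition e_aff (a : 'I_d.-1) : affine_periplectic_brauer :=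
  alg_proj affine_relations_proper (free_gen K (inl (inr a) : affine_gen)).
Definition y_aff (j : 'I_d) : affine_periplectic_brauer :=
  alg_proj affine_relations_proper (free_gen K (inr j : affine_gen)).

(* The junk value 0 outside the index range is never reached below. *)
Definition at_nat (x : 'I_d.-1 -> periplectic_brauer) (a : nat) :
    periplectic_brauer :=
  if insub a is Some i then x i else 0.

(* s_i ... s_(j-2) x_(j-1) s_(j-2) ... s_i; the formula is unaffected by the
   shift of indices. *)
Definition conj_word (x : 'I_d.-1 -> periplectic_brauer) (i j : nat) :
    periplectic_brauer :=
  \prod_(a <- index_iota i j.-1) at_nat s_hat a * at_nat x j.-1 *
  \prod_(a <- rev (index_iota i j.-1)) at_nat s_hat a.

Definition transp (i j : nat) : periplectic_brauer := conj_word s_hat i j.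
Definition transp_bar (i j : nat) : periplectic_brauer := conj_word e_hat i j.

Definition jucys_murphy (j : 'I_d) : periplectic_brauer :=
  \sum_(0 <= k < j) (transp k j + transp_bar k j).

End PeriplecticBrauer.

(* Main.v *)
Require Import Defs.
From HB Require Import structures.
From mathcomp Require Import all_boot all_order all_algebra zify.
From mathcomp Require Import generic_quotient finmap reals complex monalg.

(** A homomorphism out of an algebra given by generators and relations is the
same thing as a family of images satisfying the relations.  So the content is
that the Jucys-Murphy elements satisfy the relations imposed on the y_j; the
relations between the s_a and e_a alone hold in the target by definition.
Surjectivity is then clear, because the target is generated by the images of
the s_a and e_a, and uniqueness because a homomorphism is determined by its
values on generators.

Count indices from 0 and put w_a = s_a + e_a.  The summand of z_(j+1) with
index k is the conjugate of w_j by s_k, ..., s_(j-1).  The identity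
s_(a+1) w_a s_(a+1) = s_a w_(a+1) s_a ([brauer_conj]) says that conjugation by
s_(j+1) raises the upper index of such a term, whence the recursion
z_(j+1) = s_j z_j s_j + w_j ([jm_rec]).  Everything follows from it.

Multiplying the recursion by s_j gives the relations between s_j, y_j and
y_(j+1).  The ones between e_j and y_j - y_(j+1) reduce in the same way to
e_j z_j (1 + s_j) = 0 = (1 - s_j) z_j e_j; these are checked term by term,
since a term of z_j is w_(j-1) conjugated by elements that commute with s_j and
e_j, and this leaves an identity between generators with adjacent indices
([e_jm_term_killr], [jm_term_e_killl]).

As for commutation, z_j is built from generators of index less than j, so it
commutes with those of index more than j.  To see that s_b and e_b commute
with z_j when b + 1 < j, the recursion reduces to j = b + 2, where
z_(b+2) = (s_(b+1) s_b) z_b (s_b s_(b+1)) + s_b w_(b+1) s_b + w_(b+1).  The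
outer words turn a generator of index b into the one of index b + 1, which
commutes with z_b, and the last two summands together commute with s_b and e_b
([s_comm_base], [e_comm_base]).  Commutation of z_i with z_j for i < j is a
special case, since z_i lies in the subalgebra generated by the s_a and e_a
with a < i.  Finally the relation e_0 y_0^k e_0 = 0 holds since z_0 = 0. *)

Set Implicit Arguments.
Unset Strict Implicit.
Unset Printing Implicit Defensive.

Import GRing.Theory.
Local Open Scope ring_scope.
Local Open Scope complex_scope.

(** * Homomorphisms out of free algebras and their quotients *)

Section FreeLift.
Variables (K : comNzRingType) (X : choiceType) (B : algType K) (v : X -> B).

Definition word_prod (m : {fmonom X}) : B := \prod_(x <- m) v x.

Lemma word_prod_mmorphism : mmorphism word_prod.
Proof.
split=> [m1 m2|]; first by rewrite /word_prod fmM big_cat.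
by rewrite /word_prod fm1 big_nil.
Qed.

HB.instance Definition _ :=
  isMultiplicative.Build {fmonom X} B word_prod word_prod_mmorphism.

Definition free_lift : free_alg K X -> B := mmap (in_alg B) word_prod.

Lemma free_lift_zmod : zmod_morphism free_lift.
Proof. by move=> x y; rewrite /free_lift mmapB. Qed.

HB.instance Definition _ :=
  GRing.isZmodMorphism.Build (free_alg K X) B free_lift free_lift_zmod.

(** The algebra [B] is noncommutative; multiplicativity rests on its scalars
being central. *)
Lemma free_lift_monoid : monoid_morphism free_lift.
Proof.
have [fM f1] := @commr_mmap_is_multiplicative _ _ _ (in_alg B) word_prod
  (fun g m m' => etrans (mulr_algl _ _) (esym (mulr_algr _ _))).
by split.
Qed.

HB.instance Definition _ :=
  GRing.isMonoidMorphism.Build (free_alg K X) B free_lift free_lift_monoid.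

Lemma free_lift_scalable : scalable free_lift.
Proof. by move=> c x; rewrite /free_lift mmapZ mulr_algl. Qed.

HB.instance Definition _ :=
  GRing.isScalable.Build K (free_alg K X) B *:%R free_lift free_lift_scalable.

Lemma free_lift_gen x : free_lift (free_gen K x) = v x.
Proof. by rewrite /free_lift mmapU /= /word_prod fmU big_seq1 scale1r mul1r. Qed.

End FreeLift.

(** Monomials are products of generators, which is why a homomorphism is
determined by its values on generators. *)
Lemma free_alg_monomial (K : comNzRingType) (X : choiceType) (c : K)
    (m : {fmonom X}) :
  mkmalgU m c = c *: \prod_(x <- m) free_gen K x :> free_alg K X.
Proof.
rewrite -[m]fmK; case: m => /= s; elim: s c => [|x s IHs] c.
  rewrite big_nil; apply/malgP => k.
  by rewrite mcoeffZ mcoeffU mcoeff1 -fmoneE eq_sym mulr_natr.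
have -> : mkmalgU (FMonom (x :: s)) c = free_gen K x * mkmalgU (FMonom s) c
    :> free_alg K X.
  by rewrite [RHS]fgmulUU mul1r; congr mkmalgU; apply/eqP; rewrite fmP fmM fmU.
by rewrite IHs big_cons scalerAr.
Qed.

Lemma free_alg_ext (K : comNzRingType) (X : choiceType) (B : algType K)
    (f g : {lrmorphism free_alg K X -> B}) :
  (forall x, f (free_gen K x) = g (free_gen K x)) -> f =1 g.
Proof.
move=> fg u.
have -> : u = \sum_(m <- msupp u) u@_m *: \prod_(x <- m) free_gen K x
    :> free_alg K X.
  by rewrite [LHS]monalgE; apply: eq_bigr => m _; apply: free_alg_monomial.
rewrite !linear_sum; apply: eq_bigr => m _.
rewrite !linearZ_LR !rmorph_prod; congr (_ *: _).
by apply: eq_bigr => x _; apply: fg.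
Qed.

(** Carrying the proof that [f] respects the relations as an argument lets the
morphism structure, which depends on this proof, be inferred from the
function. *)
Definition alg_quot_lift (K : comNzRingType) (A B : algType K)
    (E : A -> A -> Prop) (properE : ~ rel_ideal E 1) (f : {lrmorphism A -> B})
    of (forall l r, E l r -> f l = f r) : alg_quot properE -> B :=
  fun q => f (repr q).

Section QuotientLift.
Variables (K : comNzRingType) (A B : algType K) (E : A -> A -> Prop).
Variables (properE : ~ rel_ideal E 1) (f : {lrmorphism A -> B}).
Hypothesis fE : forall l r, E l r -> f l = f r.

Local Notation Q := (alg_quot properE).
Local Notation lift := (alg_quot_lift (properE := properE) fE).

Lemma alg_proj_surj (q : Q) : exists x, alg_proj properE x = q.
Proof. by exists (repr q); apply: reprK. Qed.

Lemma alg_quot_lift_proj x : lift (alg_proj properE x) = f x.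
Proof.
apply/eqP; rewrite -subr_eq0 -rmorphB; apply/eqP.
apply: (rel_ideal_ker fE); apply/(alg_projP properE); exact: reprK.
Qed.

Lemma alg_quot_lift_zmod : zmod_morphism lift.
Proof.
move=> p q; have [x <-] := alg_proj_surj p; have [y <-] := alg_proj_surj q.
by rewrite -rmorphB !alg_quot_lift_proj rmorphB.
Qed.

HB.instance Definition _ :=
  GRing.isZmodMorphism.Build Q B lift alg_quot_lift_zmod.

Lemma alg_quot_lift_monoid : monoid_morphism lift.
Proof.
split=> [|p q].
  by rewrite -(rmorph1 (alg_proj properE)) alg_quot_lift_proj rmorph1.
have [x <-] := alg_proj_surj p; have [y <-] := alg_proj_surj q.
by rewrite -rmorphM !alg_quot_lift_proj rmorphM.
Qed.

HB.instance Definition _ :=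
  GRing.isMonoidMorphism.Build Q B lift alg_quot_lift_monoid.

Lemma alg_quot_lift_scalable : scalable lift.
Proof.
move=> c q; have [x <-] := alg_proj_surj q.
by rewrite -linearZ !alg_quot_lift_proj linearZ.
Qed.

HB.instance Definition _ :=
  GRing.isScalable.Build K Q B *:%R lift alg_quot_lift_scalable.

End QuotientLift.

(** * Jucys-Murphy elements in a ring with Brauer relations *)

(** Passing through [u] turns [x] into [x'], which passes [z] and is turned back
by [v]. *)
Lemma comm_intertwined (A : pzSemiRingType) (x x' u v z : A) :
  x * u = u * x' -> x' * v = v * x -> GRing.comm x' z ->
  GRing.comm x (u * z * v).
Proof.
move=> xu xv xz; rewrite /GRing.comm !mulrA xu -[u * x' * z]mulrA xz !mulrA.
by rewrite -[u * z * x' * v]mulrA xv !mulrA.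
Qed.

Lemma sandwich_conj (A : pzSemiRingType) (g x y t : A) :
  GRing.comm x g -> GRing.comm y g -> x * (g * t * g) * y = g * (x * t * y) * g.
Proof. by move=> xg yg; rewrite !mulrA xg -!mulrA yg. Qed.

(** The generators are indexed by all natural numbers and vanish beyond the
range, so that successors of indices need no proofs of bounds and commutation
of distant generators holds without range conditions. *)
Section JucysMurphy.
Variables (A : nzRingType) (d : nat) (s e : nat -> A).
Local Notation n := d.-1.
Local Notation w a := (s a + e a).
Hypothesis brauerP : forall l r,
  brauer_rel (fun a : 'I_d.-1 => s a) (fun a : 'I_d.-1 => e a) l r -> l = r.
Hypothesis s_out : forall a, (n <= a)%N -> s a = 0.
Hypothesis e_out : forall a, (n <= a)%N -> e a = 0.

Let s_sq a : (a < n)%N -> s a * s a = 1.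
Proof.
by move=> h; rewrite -expr2; apply: (brauerP (rel_ss _ _ (Ordinal h : 'I_n))).
Qed.

Let e_sq a : (a < n)%N -> e a * e a = 0.
Proof.
by move=> h; rewrite -expr2; apply: (brauerP (rel_ee _ _ (Ordinal h : 'I_n))).
Qed.

Let es a : (a < n)%N -> e a * s a = - e a.
Proof. by move=> h; apply: (brauerP (rel_es _ _ (Ordinal h : 'I_n))). Qed.

Let se a : (a < n)%N -> s a * e a = e a.
Proof.
move=> h; apply: oppr_inj; apply/esym.
by apply: (brauerP (rel_se _ _ (Ordinal h : 'I_n))).
Qed.

Section Adjacent.
Variable c : nat.
Hypothesis c1n : (c.+1 < n)%N.
Let o : 'I_n := Ordinal (ltnW c1n).
Let o' : 'I_n := Ordinal c1n.
Let oo' : o' = o.+1 :> nat. Proof. by []. Qed.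

Let braid : s c * s c.+1 * s c = s c.+1 * s c * s c.+1.
Proof. exact: (brauerP (rel_braid _ _ oo')). Qed.

Let see : s c * e c.+1 * e c = - (s c.+1 * e c).
Proof. exact: (brauerP (rel_see _ _ oo')). Qed.

Let ees : e c * e c.+1 * s c = e c * s c.+1.
Proof. exact: (brauerP (rel_ees _ _ oo')). Qed.

Let ees' : e c.+1 * e c * s c.+1 = - (e c.+1 * s c).
Proof. exact: (brauerP (rel_ees' _ _ oo')). Qed.

Let see' : s c.+1 * e c * e c.+1 = s c * e c.+1.
Proof. exact: (brauerP (rel_see' _ _ oo')). Qed.

Let eee : e c * e c.+1 * e c = - e c.
Proof. exact: (brauerP (rel_eee _ _ oo')). Qed.

Let e1e0 : e c.+1 * e c = - (s c * s c.+1 * e c).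
Proof. by rewrite -mulrA -mulrN -see !mulrA s_sq ?mul1r // ltnW. Qed.

Let e1e0' : e c.+1 * e c = - (e c.+1 * s c * s c.+1).
Proof. by rewrite -mulNr -ees' -[RHS]mulrA s_sq ?mulr1. Qed.

Let e0e1 : e c * e c.+1 = s c.+1 * s c * e c.+1.
Proof. by rewrite -mulrA -see' !mulrA s_sq ?mul1r. Qed.

Let e0e1' : e c * e c.+1 = e c * s c.+1 * s c.
Proof. by rewrite -ees -mulrA s_sq ?mulr1 // ltnW. Qed.

(** For the s-part this is the braid relation; for the e-part insert
e_c = - e_c e_(c+1) e_c in the middle of s_(c+1) e_c s_(c+1). *)
Lemma brauer_conj : s c.+1 * w c * s c.+1 = s c * w c.+1 * s c.
Proof.
rewrite !(mulrDl, mulrDr) braid; congr (_ + _).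
apply: oppr_inj; rewrite -mulNr -mulrN -eee !mulrA see'.
by rewrite -!mulrA [e c.+1 * (e c * _)]mulrA ees' mulrN mulrA.
Qed.

Lemma s_intertwine : s c * (s c.+1 * s c) = s c.+1 * s c * s c.+1.
Proof. by rewrite mulrA. Qed.

Lemma s_intertwine' : s c.+1 * (s c * s c.+1) = s c * s c.+1 * s c.
Proof. by rewrite mulrA. Qed.

Lemma e_intertwine : e c * (s c.+1 * s c) = s c.+1 * s c * e c.+1.
Proof. by rewrite mulrA -e0e1' e0e1. Qed.

Lemma e_intertwine' : e c.+1 * (s c * s c.+1) = s c * s c.+1 * e c.
Proof. by apply: oppr_inj; rewrite mulrA -e1e0' e1e0. Qed.

Let y := s c * w c.+1 * s c + w c.+1.

(** Both products are s_c w_(c+1) + w_(c+1) s_c, because s_c is an involution. *)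
Lemma s_comm_base : GRing.comm (s c) y.
Proof.
rewrite /GRing.comm /y mulrDr mulrDl !mulrA s_sq ?mul1r; last exact: ltnW.
by rewrite -[_ * s c * s c]mulrA s_sq ?mulr1 ?[_ + s c * _]addrC // ltnW.
Qed.

(** Both products vanish. *)
Lemma e_comm_base : GRing.comm (e c) y.
Proof.
have cn := ltnW c1n.
have absorb x : x * s c * e c = x * e c by rewrite -mulrA se.
rewrite /GRing.comm /y !(mulrDl, mulrDr) !mulrA es // !mulNr ees -e0e1'.
rewrite !absorb see e1e0.
by rewrite !addrA !subrK addNr subrr.
Qed.

Lemma e_killr_base : e c.+1 * w c * (1 + s c.+1) = 0.
Proof.
rewrite !(mulrDl, mulrDr) !mulr1 ees' e1e0'.
by rewrite addrA subrK subrr.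
Qed.

Lemma e_killl_base : (1 - s c.+1) * w c * e c.+1 = 0.
Proof.
rewrite !(mulrDl, mulrDr) !mulNr !mul1r see' e0e1.
by rewrite addrA addrK subrr.
Qed.

End Adjacent.

Lemma brauer_far a b : (a.+1 < b)%N || (b.+1 < a)%N ->
  [/\ GRing.comm (s a) (s b), GRing.comm (s a) (e b),
      GRing.comm (e a) (s b) & GRing.comm (e a) (e b)].
Proof.
rewrite /GRing.comm => ab.
have [an|an] := leqP n a; first by rewrite (s_out an) (e_out an) !(mul0r, mulr0).
have [bn|bn] := leqP n b; first by rewrite (s_out bn) (e_out bn) !(mul0r, mulr0).
pose oa : 'I_n := Ordinal an; pose ob : 'I_n := Ordinal bn.
have fab : far oa ob by rewrite /far /=; lia.
have fba : far ob oa by rewrite /far /=; lia.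
split; [| |apply/esym|].
- exact: (brauerP (rel_ss_far _ _ fab)).
- exact: (brauerP (rel_se_far _ _ fab)).
- exact: (brauerP (rel_se_far _ _ fba)).
- exact: (brauerP (rel_ee_far _ _ fab)).
Qed.

(** For k <= j, the summand (k, j+1) + bar (k, j+1) of the Jucys-Murphy element
with index j + 1, positions being counted from 0. *)
Definition jm_term k j : A :=
  \prod_(a <- index_iota k j) s a * w j * \prod_(a <- rev (index_iota k j)) s a.

Definition jm_elt j : A := \sum_(0 <= k < j) jm_term k j.-1.

Lemma jm_term_diag j : jm_term j j = w j.
Proof. by rewrite /jm_term /index_iota subnn !big_nil mul1r mulr1. Qed.

Lemma jm_term_conj k j : (k < j)%N -> jm_term k j = s k * jm_term k.+1 j * s k.
Proof.
move=> kj; rewrite /jm_term.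
have -> : index_iota k j = k :: index_iota k.+1 j by rewrite /index_iota -subnSK.
by rewrite rev_cons big_rcons big_cons !mulrA.
Qed.

Lemma comm_jm_term x k j :
  (forall a, (a <= j)%N -> GRing.comm x (s a) /\ GRing.comm x (e a)) ->
  GRing.comm x (jm_term k j).
Proof.
move=> xC; have sC a : a \in index_iota k j -> GRing.comm x (s a).
  by rewrite mem_index_iota => /andP[_ /ltnW /xC[]].
apply: commrM; first apply: commrM.
- by rewrite big_seq; apply: commr_prod => a /sC.
- by have [] := xC j (leqnn j); apply: commrD.
- by rewrite big_seq; apply: commr_prod => a; rewrite mem_rev => /sC.
Qed.

Lemma comm_jm x j :
  (forall a, (a < j)%N -> GRing.comm x (s a) /\ GRing.comm x (e a)) ->
  GRing.comm x (jm_elt j).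
Proof.
move=> xC; rewrite /jm_elt big_nat; apply: commr_sum => k /andP[_ kj].
by apply: comm_jm_term => a aj; apply: xC; lia.
Qed.

(** The letters of [jm_elt j] all have index less than [j]. *)
Lemma jm_far a j : (j < a)%N ->
  GRing.comm (s a) (jm_elt j) /\ GRing.comm (e a) (jm_elt j).
Proof.
move=> ja; split; apply: comm_jm => b bj;
  by have [//|? ? ? ?] := @brauer_far a b; first by lia.
Qed.

(** The conjugations by s_k, ..., s_(j-1) commute with s_(j+1), so that only
the case k = j has content. *)
Lemma jm_term_step k j : (k <= j)%N -> (j.+1 < n)%N ->
  jm_term k j.+1 = s j.+1 * jm_term k j * s j.+1.
Proof.
move=> kj jn; rewrite -(subKn kj).
elim: (j - k)%N (leq_subr k j) => [_|i IHi ij].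
  by rewrite subn0 jm_term_conj // !jm_term_diag brauer_conj.
have [sC _ _ _] := @brauer_far (j - i.+1) j.+1 ltac:(lia).
have jiS : (j - i.+1).+1 = (j - i)%N by lia.
rewrite jm_term_conj; last by lia.
rewrite [in RHS]jm_term_conj; last by lia.
by rewrite jiS IHi ?(ltnW ij) // sandwich_conj //; apply: commr_sym.
Qed.

Lemma jm_rec j : (j < n)%N -> jm_elt j.+1 = s j * jm_elt j * s j + w j.
Proof.
case: j => [_|j jn].
  by rewrite /jm_elt big_nat1 big_geq // mulr0 mul0r add0r jm_term_diag.
rewrite {1}/jm_elt big_nat_recr //= jm_term_diag; congr (_ + _).
rewrite /jm_elt mulr_sumr mulr_suml !big_nat; apply: eq_bigr => k /andP[_ kj].
exact: jm_term_step.
Qed.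

(** Below the top index the recursion carries commutation along; the case
j = b + 2 is where the recursion is used twice. *)
Lemma jm_near b j : (b.+1 < j)%N -> (j <= n)%N ->
  GRing.comm (s b) (jm_elt j) /\ GRing.comm (e b) (jm_elt j).
Proof.
elim: j => // j IHj bj jn.
rewrite jm_rec //; move: bj; rewrite ltnS leq_eqVlt => /predU1P[bj|bj];
  last first.
  have [sC eC] := IHj bj (ltnW jn).
  have [ss_ se_ es_ ee_] : [/\ GRing.comm (s b) (s j), GRing.comm (s b) (e j),
      GRing.comm (e b) (s j) & GRing.comm (e b) (e j)] by apply: brauer_far; lia.
  by split; apply: commrD; do ?[apply: commrM => // | apply: commrD => //].
case: j / bj jn {IHj} => bn.
have [sC eC] := jm_far (ltnSn b).
rewrite jm_rec ?(ltnW bn) // mulrDr mulrDl brauer_conj // -addrA.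
have -> : s b.+1 * (s b * jm_elt b * s b) * s b.+1 =
    s b.+1 * s b * jm_elt b * (s b * s b.+1) by rewrite !mulrA.
have [sC' eC'] := jm_far (ltnW (ltnSn b.+1)).
split; apply: commrD.
- exact: (comm_intertwined (s_intertwine bn) (s_intertwine' bn)).
- exact: s_comm_base.
- exact: (comm_intertwined (e_intertwine bn) (e_intertwine' bn)).
- exact: e_comm_base.
Qed.

Lemma jm_comm i j : (i <= n)%N -> (j <= n)%N -> GRing.comm (jm_elt i) (jm_elt j).
Proof.
wlog ij : i j / (i <= j)%N.
  by move=> wl iN jN; case/orP: (leq_total i j) => ij;
    [|apply/commr_sym]; apply: wl.
move=> _ jn; move: ij; rewrite leq_eqVlt => /predU1P[-> //|ij].
apply/commr_sym/comm_jm => a ai.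
by have [||sC eC] := @jm_near a j; [lia|lia|split; apply/commr_sym].
Qed.

(** The conjugations by s_k, ..., s_(j-1) commute with both outer factors and
can be pulled out, which leaves [e_killr_base]. *)
Lemma e_jm_term_killr k j : (k <= j)%N -> (j.+1 < n)%N ->
  e j.+1 * jm_term k j * (1 + s j.+1) = 0.
Proof.
move=> kj jn; rewrite -(subKn kj).
elim: (j - k)%N (leq_subr k j) => [_|i IHi ij].
  by rewrite subn0 jm_term_diag e_killr_base.
have [sC _ eC _] := @brauer_far j.+1 (j - i.+1) ltac:(lia).
have jiS : (j - i.+1).+1 = (j - i)%N by lia.
rewrite jm_term_conj ?jiS; last by lia.
rewrite sandwich_conj //; last by apply/commr_sym/commrD; [apply: commr1|].
by rewrite IHi ?(ltnW ij) // mulr0 mul0r.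
Qed.

Lemma jm_term_e_killl k j : (k <= j)%N -> (j.+1 < n)%N ->
  (1 - s j.+1) * jm_term k j * e j.+1 = 0.
Proof.
move=> kj jn; rewrite -(subKn kj).
elim: (j - k)%N (leq_subr k j) => [_|i IHi ij].
  by rewrite subn0 jm_term_diag e_killl_base.
have [sC _ eC _] := @brauer_far j.+1 (j - i.+1) ltac:(lia).
have jiS : (j - i.+1).+1 = (j - i)%N by lia.
rewrite jm_term_conj ?jiS; last by lia.
rewrite sandwich_conj //; last by apply/commr_sym/commrB; [apply: commr1|].
by rewrite IHi ?(ltnW ij) // mulr0 mul0r.
Qed.

Lemma e_jm_s j : (j < n)%N -> e j * jm_elt j * s j = - (e j * jm_elt j).
Proof.
case: j => [|j] jn; first by rewrite /jm_elt big_geq // mulr0 mul0r oppr0.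
apply/eqP; rewrite -addr_eq0 addrC -{1}[e _ * _]mulr1 -mulrDr; apply/eqP.
rewrite /jm_elt mulr_sumr mulr_suml big_nat big1 // => k /andP[_ kj].
exact: e_jm_term_killr.
Qed.

Lemma s_jm_e j : (j < n)%N -> s j * jm_elt j * e j = jm_elt j * e j.
Proof.
case: j => [|j] jn; first by rewrite /jm_elt big_geq // mulr0 mul0r.
apply/esym/eqP; rewrite -subr_eq0 -mulrBl -{1}[jm_elt _]mul1r -mulrBl; apply/eqP.
rewrite /jm_elt mulr_sumr mulr_suml big_nat big1 // => k /andP[_ kj].
exact: jm_term_e_killl.
Qed.

Lemma jm_affine_rel l r :
  affine_brauer_rel (fun a : 'I_n => s a) (fun a : 'I_n => e a)
    (fun j : 'I_d => jm_elt j) l r -> l = r.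
Proof.
have jmC (a : 'I_n) (i : 'I_d) : i != a :> nat -> i != a.+1 :> nat ->
    GRing.comm (s a) (jm_elt i) /\ GRing.comm (e a) (jm_elt i).
  move=> ia iSa; have [an id] := (ltn_ord a, ltn_ord i).
  have [lt_ia|le_ai] := ltnP i a; first exact: jm_far.
  by apply: jm_near; lia.
case=> [u v|a i ia iSa|a i k _ i0 k1|a i ia iSa|i j
  |a i i' ->->|a i i' ->->|a i i' ->->|a i i' ->->].
- exact: brauerP.
- by have [] := jmC a i ia iSa.
- by rewrite i0 /jm_elt big_geq // expr0n eqn0Ngt k1 mulr0 mul0r.
- by have [] := jmC a i ia iSa.
- by apply: jm_comm; rewrite -ltnS (leq_trans (ltn_ord _)) // leqSpred.
- have an := ltn_ord a; rewrite jm_rec // !mulrDl s_sq // es //.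
  by rewrite -[_ * s a * s a]mulrA s_sq // mulr1 opprD addNKr opprB.
- have an := ltn_ord a; rewrite jm_rec // !mulrDr s_sq // se // !mulrA s_sq //.
  by rewrite mul1r !opprD addNKr addrC.
- have an := ltn_ord a; rewrite jm_rec // mulrBr !mulrDr es // e_sq //.
  by rewrite !mulrA es // !mulNr e_jm_s // opprK addr0 opprB addrCA subrr addr0.
- have an := ltn_ord a; rewrite jm_rec // mulrBl !mulrDl se // e_sq //.
  by rewrite -[_ * s a * e a]mulrA se // s_jm_e // addr0 opprD addNKr.
Qed.

End JucysMurphy.

(** * Transport of the relations along homomorphisms *)

Lemma brauer_rel_morph (A B : nzRingType) (f : {rmorphism A -> B}) (d : nat)
    (s e : 'I_d.-1 -> A) (s' e' : 'I_d.-1 -> B) l r :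
  (forall a, f (s a) = s' a) -> (forall a, f (e a) = e' a) ->
  brauer_rel s e l r -> brauer_rel s' e' (f l) (f r).
Proof.
move=> fs fe; case=> *;
rewrite ?(rmorphN, rmorphM, rmorphXn, rmorph1, rmorph0) /= ?fs ?fe;
by constructor.
Qed.

(** Taking [f] to be the projection onto a presented algebra shows that the
generators of the latter satisfy its defining relations: these are images of
relations upstairs, constructor by constructor. *)
Lemma brauer_rel_holds (A B : nzRingType) (f : {rmorphism A -> B}) (d : nat)
    (s e : 'I_d.-1 -> A) (s' e' : 'I_d.-1 -> B) :
  (forall a, f (s a) = s' a) -> (forall a, f (e a) = e' a) ->
  (forall l r, brauer_rel s e l r -> f l = f r) ->
  forall l r, brauer_rel s' e' l r -> l = r.
Proof.
move=> fs fe fE l r; case=>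
  [a|a b ab|c c' cc'|a|a b ab|a b ab|a|a
  |c c' cc'|c c' cc'|c c' cc'|c c' cc'|c c' cc'|c c' cc'];
  [ have := fE _ _ (rel_ss s e a) | have := fE _ _ (rel_ss_far s e ab)
  | have := fE _ _ (rel_braid s e cc') | have := fE _ _ (rel_ee s e a)
  | have := fE _ _ (rel_se_far s e ab) | have := fE _ _ (rel_ee_far s e ab)
  | have := fE _ _ (rel_es s e a) | have := fE _ _ (rel_se s e a)
  | have := fE _ _ (rel_see s e cc') | have := fE _ _ (rel_ees s e cc')
  | have := fE _ _ (rel_ees' s e cc') | have := fE _ _ (rel_see' s e cc')
  | have := fE _ _ (rel_eee' s e cc') | have := fE _ _ (rel_eee s e cc')];
  by rewrite ?(rmorphN, rmorphM, rmorphXn, rmorph1, rmorph0) /= ?fs ?fe.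
Qed.

Lemma affine_brauer_rel_morph (A B : nzRingType) (f : {rmorphism A -> B})
    (d : nat) (s e : 'I_d.-1 -> A) (y : 'I_d -> A)
    (s' e' : 'I_d.-1 -> B) (y' : 'I_d -> B) l r :
  (forall a, f (s a) = s' a) -> (forall a, f (e a) = e' a) ->
  (forall j, f (y j) = y' j) ->
  affine_brauer_rel s e y l r -> affine_brauer_rel s' e' y' (f l) (f r).
Proof.
move=> fs fe fy; case=> [u v uv|||||||| ] *;
  first by apply: rel_brauer; apply: brauer_rel_morph uv.
all: rewrite ?(rmorphN, rmorphB, rmorphM, rmorphXn, rmorph1, rmorph0) /=.
all: rewrite ?fs ?fe ?fy.
all: by constructor.
Qed.

(** * The homomorphism onto the periplectic Brauer algebra *)

Section Homomorphism.
Variables (K : comNzRingType) (d : nat).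
Local Notation P := (affine_periplectic_brauer K d).
Local Notation B := (periplectic_brauer K d).
Local Notation s := (at_nat (s_hat K (d := d))).
Local Notation e := (at_nat (e_hat K (d := d))).

Lemma at_nat_ord (x : 'I_d.-1 -> B) (a : 'I_d.-1) : at_nat x a = x a.
Proof. by rewrite /at_nat valK. Qed.

Lemma at_nat_out (x : 'I_d.-1 -> B) (a : nat) : (d.-1 <= a)%N -> at_nat x a = 0.
Proof. by move=> da; rewrite /at_nat insubN // -leqNgt. Qed.

Lemma periplectic_brauerP (l r : B) :
  brauer_rel (fun a : 'I_d.-1 => s a) (fun a : 'I_d.-1 => e a) l r -> l = r.
Proof.
apply: (@brauer_rel_holds _ _ (alg_proj (@brauer_relations_proper K d)) _
  (fun a => free_gen K (inl a : brauer_gen d))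
  (fun a => free_gen K (inr a : brauer_gen d))) => [a|a|l' r' lr].
- by rewrite at_nat_ord.
- by rewrite at_nat_ord.
- by apply/alg_projP; rewrite -[_ - _]mulr1 -[_ - _]mul1r; constructor.
Qed.

Lemma jucys_murphyE (j : 'I_d) : jucys_murphy K j = jm_elt s e j.
Proof.
rewrite /jucys_murphy /jm_elt; apply: eq_bigr => k _.
by rewrite /jm_term mulrDr mulrDl.
Qed.

Definition affine_image (x : affine_gen d) : B :=
  match x with
  | inl (inl a) => s_hat K a
  | inl (inr a) => e_hat K a
  | inr j => jucys_murphy K j
  end.

Lemma affine_image_rel l r :
  affine_relations (K := K) (d := d) l r ->
  free_lift affine_image l = free_lift affine_image r.
Proof.
move=> lr.
apply: (jm_affine_rel periplectic_brauerP (at_nat_out _) (at_nat_out _)).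
apply: affine_brauer_rel_morph lr => a; rewrite [LHS]free_lift_gen /=.
- by rewrite at_nat_ord.
- by rewrite at_nat_ord.
- exact: jucys_murphyE.
Qed.

Definition affine_to_brauer : {lrmorphism P -> B} :=
  alg_quot_lift (properE := @affine_relations_proper K d) affine_image_rel.

Lemma affine_to_brauer_gen (x : affine_gen d) :
  affine_to_brauer (alg_proj (@affine_relations_proper K d) (free_gen K x)) =
  affine_image x.
Proof. exact: etrans (alg_quot_lift_proj _ _ _) (free_lift_gen _ _). Qed.

(** A word in the s_a and e_a of the target is the image of the same word in the
source. *)
Lemma affine_to_brauer_surj (b : B) : exists a, affine_to_brauer a = b.
Proof.
have [u <-] := @alg_proj_surj _ _ _ (@brauer_relations_proper K d) b.
pose v (x : brauer_gen d) : P :=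
  match x with inl a => s_aff K a | inr a => e_aff K a end.
exists (free_lift v u).
apply: (@free_alg_ext _ _ _ (affine_to_brauer \o free_lift v)
  (alg_proj (@brauer_relations_proper K d))).
case=> a /=; rewrite free_lift_gen.
- exact: (affine_to_brauer_gen (inl (inl a))).
- exact: (affine_to_brauer_gen (inl (inr a))).
Qed.

Lemma affine_hom_ext (C : algType K) (f g : {lrmorphism P -> C}) :
  (forall a, f (s_aff K a) = g (s_aff K a)) ->
  (forall a, f (e_aff K a) = g (e_aff K a)) ->
  (forall j, f (y_aff K j) = g (y_aff K j)) -> f =1 g.
Proof.
move=> fs fe fy p.
have [u <-] := @alg_proj_surj _ _ _ (@affine_relations_proper K d) p.
apply: (@free_alg_ext _ _ _ (f \o alg_proj (@affine_relations_proper K d))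
  (g \o alg_proj (@affine_relations_proper K d))).
by case=> [[a|a]|j] /=; [apply: fs | apply: fe | apply: fy].
Qed.

End Homomorphism.

Theorem theorem4p1 (R : realType) (d : nat) (hd : (1 <= d)%N) :
  exists pi : {lrmorphism affine_periplectic_brauer R[i] d ->
                          periplectic_brauer R[i] d},
    [/\ forall a : 'I_d.-1, pi (s_aff R[i] a) = s_hat R[i] a,
        forall a : 'I_d.-1, pi (e_aff R[i] a) = e_hat R[i] a,
        forall j : 'I_d, pi (y_aff R[i] j) = jucys_murphy R[i] j,
        forall b : periplectic_brauer R[i] d,
          exists a : affine_periplectic_brauer R[i] d, pi a = b &
        forall pi' : {lrmorphism affine_periplectic_brauer R[i] d ->
                                 periplectic_brauer R[i] d},
          (forall a : 'I_d.-1, pi' (s_aff R[i] a) = s_hat R[i] a) ->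
          (forall a : 'I_d.-1, pi' (e_aff R[i] a) = e_hat R[i] a) ->
          (forall j : 'I_d, pi' (y_aff R[i] j) = jucys_murphy R[i] j) ->
          pi' =1 pi].
Proof.
exists (affine_to_brauer R[i] d).
have gs a : affine_to_brauer R[i] d (s_aff R[i] a) = s_hat R[i] a.
  exact: (affine_to_brauer_gen _ (inl (inl a))).
have ge a : affine_to_brauer R[i] d (e_aff R[i] a) = e_hat R[i] a.
  exact: (affine_to_brauer_gen _ (inl (inr a))).
have gy j : affine_to_brauer R[i] d (y_aff R[i] j) = jucys_murphy R[i] j.
  exact: (affine_to_brauer_gen _ (inr j)).
split=> //; first exact: affine_to_brauer_surj.
move=> pi' hs he hy; apply: affine_hom_ext => [a|a|j].
- by rewrite hs gs.
- by rewrite he ge.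
- by rewrite hy gy.
Qed.
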